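(* Let $(x_n)_{n\ge 0}$ be a sequence of complex numbers satisfying $x_{n+2}=x_{n+1}+x_n$ for every integer $n\ge 0$, and for every integer $n\ge 1$ let $S_n=\sum_{k=0}^{n-1}x_k$. For every positive integer $n$ with $n\equiv 2\pmod 4$, $$S_n=\mathcal{L}_{n/2}\,x_{n/2+1},$$ where $(\mathcal{L}_k)_{k\ge 0}$ denotes the sequence of Lucas numbers.
   Context: The Lucas numbers are defined by $\mathcal{L}_0=2$, $\mathcal{L}_1=1$, $\mathcal{L}_{n+2}=\mathcal{L}_{n+1}+\mathcal{L}_n$ for $n\ge 0$. *)

(* Defs.v *)
From mathcomp Require Import all_boot.

Set Implicit Arguments.
Unset Strict Implicit.
Unset Printing Implicit Defensive.

Fixpoint lucas (n : nat) : nat :=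
  match n with
  | 0 => 2
  | n'.+1 => match n' with
             | 0 => 1
             | n''.+1 => lucas n' + lucas n''
             end
  end.

(* Main.v *)
Require Import Defs.
From mathcomp Require Import all_boot all_order all_algebra.
From mathcomp Require Import reals complex.
From mathcomp Require Import zify ring.
Import GRing.Theory.
Local Open Scope ring_scope.

(** The recurrence makes the partial sums telescope: [x k = x k.+2 - x k.+1],
    so the sum of the first [n] terms is [x n.+1 - x 1] ([sum_fib_rec]).
    On the other hand, the solutions of the recurrence are the combinations of
    [phi ^+ k] and [psi ^+ k] with [phi + psi = 1] and [phi * psi = -1], while
    the Lucas number of index [m] is [phi ^+ m + psi ^+ m]; multiplying by it
    gives [L_m * x (m + j) = x (2 m + j) + (phi * psi) ^+ m * x j], that is
    [lucas_mul_fib_rec]. When [m] is odd the sign is [-1], and for [j = 1] the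
    right-hand side is exactly the telescoped sum of [2 m] terms. The congruence
    on [n] says precisely that [n = 2 m] with [m] odd. *)

Lemma sum_fib_rec (V : zmodType) (x : nat -> V)
    (hx : forall n, x n.+2 = x n.+1 + x n) n :
  \sum_(0 <= k < n) x k = x n.+1 - x 1%N.
Proof.
rewrite -(telescope_sumr (fun k => x k.+1) (leq0n n)).
by apply: eq_bigr => k _; rewrite hx addrAC subrr add0r.
Qed.

(** The Binet computation is replaced by an induction of step two on [m], valid
    over any commutative ring. The shift [j] has to vary: the instance for
    [m.+2] and [j] is the sum of those for [m.+1], [j.+1] and for [m], [j.+2],
    whose left-hand sides all carry the same factor [x (m + j).+2]. *)
Lemma lucas_mul_fib_rec (A : comNzRingType) (x : nat -> A)
    (hx : forall n, x n.+2 = x n.+1 + x n) m j :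
  (lucas m)%:R * x (m + j)%N = x (m.*2 + j)%N + (-1) ^+ m * x j.
Proof.
suff: (forall j, (lucas m)%:R * x (m + j)%N = x (m.*2 + j)%N + (-1) ^+ m * x j)
   /\ (forall j, (lucas m.+1)%:R * x (m.+1 + j)%N
                 = x (m.+1.*2 + j)%N + (-1) ^+ m.+1 * x j).
  by case=> H _; apply: H.
elim: m {j} => [|m [IH0 IH1]].
  split=> j; first by rewrite !add0n /=; ring.
  by rewrite /= !addSn !add0n hx; ring.
split=> // j.
have -> : lucas m.+2 = (lucas m.+1 + lucas m)%N by [].
rewrite natrD mulrDl.
have {1}-> : (m.+2 + j = m.+1 + j.+1)%N by lia.
have -> : (m.+2 + j = m + j.+2)%N by lia.
rewrite IH1 IH0 hx.
have -> : (m.+1.*2 + j.+1 = (m.*2 + j).+3)%N by lia.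
have -> : (m.*2 + j.+2 = (m.*2 + j).+2)%N by lia.
have -> : (m.+2.*2 + j = (m.*2 + j).+4)%N by lia.
by rewrite (hx (m.*2 + j).+2) !exprS; ring.
Qed.

Theorem theorem2 (R : realType) (x : nat -> R[i])
  (hx : forall n : nat, x n.+2 = x n.+1 + x n)
  (n : nat) (hn : (0 < n)%N) (hn4 : n = 2 %[mod 4]) :
  \sum_(0 <= k < n) x k = (lucas (n %/ 2))%:R * x (n %/ 2).+1.
Proof.
have n_double : (n = (n %/ 2).*2)%N by lia.
have m_odd : odd (n %/ 2) by lia.
rewrite sum_fib_rec // -(addn1 (n %/ 2)) lucas_mul_fib_rec // -n_double addn1.
by rewrite -signr_odd m_odd expr1 mulN1r.
Qed.
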